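(* Let $A\in\mathbb{R}_{+}^{m\times n}$. Then $$\operatorname{rk}(A)\le \operatorname{st}_{+}(AA^{T})\le \operatorname{rk}_{+}(A).$$
   Context: Here $\mathbb{R}_{+}^{m\times n}$ is the set of $m\times n$ real matrices with nonnegative entries and $\mathcal{S}_n^{+}$ is the set of symmetric $n\times n$ matrices with nonnegative entries. $\operatorname{rk}$ is the usual rank. For $A\in\mathbb{R}_{+}^{m\times n}$, the nonnegative rank $\operatorname{rk}_{+}(A)$ is the smallest integer $k$ such that $A=UV^{T}$ for some $U\in\mathbb{R}_{+}^{m\times k}$ and $V\in\mathbb{R}_{+}^{n\times k}$, with the convention $\operatorname{rk}_{+}(0)=0$. For $M\in\mathcal{S}_n^{+}$, an SN-Trifactorization of $M$ is a factorization $M=BCB^{T}$ with $B\in\mathbb{R}_{+}^{n\times k}$ and $C\in\mathcal{S}_k^{+}$; the SNT-rank $\operatorname{st}_{+}(M)$ is the smallest integer $k$ for which such a factorization exists, with the convention $\operatorname{st}_{+}(0)=0$. *)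

(* Defs.v *)
From HB Require Import structures.
From mathcomp Require Import all_boot all_order all_algebra.
From mathcomp Require Import all_classical reals.

Set Implicit Arguments.
Unset Strict Implicit.
Unset Printing Implicit Defensive.

Import Order.TTheory GRing.Theory Num.Theory.
Local Open Scope ring_scope.

(* The matrices with nonnegative entries are those with
   [A \is a mxOver Num.nneg]. *)

Definition sym_nneg (R : realType) (n : nat) (M : 'M[R]_n) : Prop :=
  M^T = M /\ M \is a mxOver Num.nneg.

Definition nn_factorizable (R : realType) (m n : nat) (A : 'M[R]_(m, n))
    (k : nat) : Prop :=
  exists (U : 'M[R]_(m, k)) (V : 'M[R]_(n, k)),
    [/\ U \is a mxOver Num.nneg, V \is a mxOver Num.nneg & A = U *m V^T].

Definition sn_trifactorizable (R : realType) (n : nat) (M : 'M[R]_n)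
    (k : nat) : Prop :=
  exists (B : 'M[R]_(n, k)) (C : 'M[R]_k),
    [/\ B \is a mxOver Num.nneg, sym_nneg C & M = B *m C *m B^T].

(* The least element of a set of natural numbers; the value 0 for the empty
   set is never used below on the intended domains, by the lemmas
   [nn_rankP] and [snt_rankP]. *)
Definition least (P : nat -> Prop) : nat :=
  xget 0%N [set k | P k /\ forall j, P j -> (k <= j)%N]%classic.

Definition nn_rank (R : realType) (m n : nat) (A : 'M[R]_(m, n)) : nat :=
  least (nn_factorizable A).

Definition snt_rank (R : realType) (n : nat) (M : 'M[R]_n) : nat :=
  least (sn_trifactorizable M).

Lemma leastP (P : nat -> Prop) : (exists k, P k) ->
  P (least P) /\ forall j, P j -> (least P <= j)%N.
Proof.
case=> k Pk; rewrite /least; case: xgetP => [x _ //|none].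
have exP : exists j, `[< P j >] by exists k; apply/asboolP.
case: (ex_minnP exP) => j /asboolP Pj minj.
by case: (none j); split=> // i /asboolP; apply: minj.
Qed.

Lemma mxOver1_nneg (R : realType) (n : nat) :
  (1%:M : 'M[R]_n) \is a mxOver Num.nneg.
Proof. by apply/mxOverP => i j; rewrite mxE nnegrE ler0n. Qed.

Lemma nn_rankP (R : realType) (m n : nat) (A : 'M[R]_(m, n)) :
  A \is a mxOver Num.nneg ->
  nn_factorizable A (nn_rank A) /\
  forall k, nn_factorizable A k -> (nn_rank A <= k)%N.
Proof.
move=> A0; apply: leastP; exists n, A, 1%:M; split=> //.
  exact: mxOver1_nneg.
by rewrite trmx1 mulmx1.
Qed.

Lemma snt_rankP (R : realType) (n : nat) (M : 'M[R]_n) :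
  sym_nneg M ->
  sn_trifactorizable M (snt_rank M) /\
  forall k, sn_trifactorizable M k -> (snt_rank M <= k)%N.
Proof.
move=> MS; apply: leastP; exists n, 1%:M, M; split=> //.
  exact: mxOver1_nneg.
by rewrite trmx1 mulmx1 mul1mx.
Qed.

Lemma sym_nneg_mul_tr (R : realType) (m n : nat) (A : 'M[R]_(m, n)) :
  A \is a mxOver Num.nneg -> sym_nneg (A *m A^T).
Proof.
move=> /mxOverP A0; split; first by rewrite trmx_mul trmxK.
apply/mxOverP => i j; rewrite nnegrE mxE; apply: sumr_ge0 => k _.
by rewrite mxE mulr_ge0 // -nnegrE A0.
Qed.

(* The conventions on zero matrices hold because inner dimension 0 is
   allowed. *)
Lemma nn_rank0 (R : realType) (m n : nat) : nn_rank (0 : 'M[R]_(m, n)) = 0%N.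
Proof.
have Z p q : (0 : 'M[R]_(p, q)) \is a mxOver Num.nneg.
  by apply/mxOverP => i j; rewrite mxE nnegrE.
have [_ min0] := nn_rankP (Z m n).
apply/eqP; rewrite -leqn0; apply: min0.
by exists 0, 0; split; rewrite ?mul0mx.
Qed.

Lemma snt_rank0 (R : realType) (n : nat) : snt_rank (0 : 'M[R]_n) = 0%N.
Proof.
have Z p q : (0 : 'M[R]_(p, q)) \is a mxOver Num.nneg.
  by apply/mxOverP => i j; rewrite mxE nnegrE.
have S p : sym_nneg (0 : 'M[R]_p) by split; rewrite ?trmx0.
have [_ min0] := snt_rankP (S n).
apply/eqP; rewrite -leqn0; apply: min0.
by exists 0, 0; split; rewrite ?mul0mx.
Qed.

(* Main.v *)
(** Over an ordered field the Gram matrix [A A^T] has the rank of [A], which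
    bounds the inner dimension of any factorization of [A A^T] from below;
    conversely [A = U V^T] gives [A A^T = U (V^T V) U^T]. *)
Require Import Defs.
From mathcomp Require Import all_boot all_order all_algebra.
From mathcomp Require Import reals.

Set Implicit Arguments.
Unset Strict Implicit.
Unset Printing Implicit Defensive.

Import GRing.Theory Num.Theory.
Local Open Scope ring_scope.

(** The [i]-th diagonal entry of [A *m A^T] is the sum of the squares of row [i] of [A], so it
    vanishes only when the whole row does. *)
Lemma mulmx_tr_eq0 (R : realDomainType) (m n : nat) (A : 'M[R]_(m, n)) :
  (A *m A^T == 0) = (A == 0).
Proof.
apply/eqP/eqP => [AAT0|->]; last by rewrite mul0mx.
apply/matrixP => i j; rewrite mxE; apply/eqP; rewrite -sqrf_eq0.
have /eqP := congr1 (fun M : 'M_m => M i i) AAT0.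
rewrite !mxE psumr_eq0 => [/allP/(_ j)|k _]; last by rewrite mxE -expr2 sqr_ge0.
by rewrite mem_index_enum mxE -expr2 => /(_ isT).
Qed.

Lemma mxrank_mul_tr (R : realFieldType) (m n : nat) (A : 'M[R]_(m, n)) :
  \rank (A *m A^T) = \rank A.
Proof.
apply/eqP; rewrite eqn_leq mxrankM_maxl /=.
have sub_ker : (kermx (A *m A^T) <= kermx A)%MS.
  (* With [K := kermx (A *m A^T)], the product of [K *m A] with its transpose is
     [K *m (A *m A^T) *m K^T = 0], hence [K *m A = 0]. *)
  apply/sub_kermxP/eqP; rewrite -mulmx_tr_eq0 trmx_mul mulmxA.
  by rewrite -(mulmxA _ A) mulmx_ker mul0mx.
(* Each kernel has rank [m] minus the rank of its matrix, so the inclusion reverses into the missing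
   inequality. *)
by have := mxrankS sub_ker; rewrite !mxrank_ker leq_sub2lE // rank_leq_row.
Qed.

Lemma sn_trifactorizable_rank (R : realType) (n k : nat) (M : 'M[R]_n) :
  sn_trifactorizable M k -> (\rank M <= k)%N.
Proof.
case=> B [C [_ _ ->]]; rewrite -mulmxA.
exact: leq_trans (mxrankM_maxl _ _) (rank_leq_col _).
Qed.

Lemma nn_factorizable_mul_tr (R : realType) (m n k : nat) (A : 'M[R]_(m, n)) :
  nn_factorizable A k -> sn_trifactorizable (A *m A^T) k.
Proof.
case=> U [V [U0 V0 ->]]; exists U, (V^T *m V); split=> //.
  (* Seen as [V^T *m V^T^T], the middle factor is the Gram matrix of the nonnegative [V^T]. *)
  rewrite -{2}(trmxK V); apply: sym_nneg_mul_tr.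
  by apply/mxOverP => i j; rewrite mxE (mxOverP V0).
by rewrite trmx_mul trmxK !mulmxA.
Qed.

Theorem proposition2p11 (R : realType) (m n : nat) (A : 'M[R]_(m, n))
    (hA : A \is a mxOver Num.nneg) :
  (\rank A <= snt_rank (A *m A^T))%N /\
  (snt_rank (A *m A^T) <= nn_rank A)%N.
Proof.
have [tri min_tri] := snt_rankP (sym_nneg_mul_tr hA).
have [fact _] := nn_rankP hA.
split; last exact/min_tri/nn_factorizable_mul_tr.
by rewrite -mxrank_mul_tr; apply: sn_trifactorizable_rank.
Qed.
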